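(* Let $\mathcal A$ be a class of graphs, and let $\mathcal C$ be a bridge-stable class of connected graphs each of which is bridge-addable in $\mathcal A$. Then for $R_n\in_u\mathcal A$ and each $n\in\mathbb N$ (with $\mathcal A_n\neq\emptyset$), $\kappa^+(R_n,\mathcal C)$ is stochastically dominated by $1+\mathrm{Po}(1)$, and $\mathbb E[\operatorname{frag}(R_n,\mathcal C)]<2$.
   Context: $\mathcal A_n$: graphs in $\mathcal A$ on vertex set $[n]$; $R_n\in_u\mathcal A$: uniform on $\mathcal A_n$. A connected graph $H$ is bridge-addable in $\mathcal A$ if whenever $G\in\mathcal A$ has a component isomorphic to $H$ and $e$ is a (non-)edge between that component and the rest of $G$, $G+e\in\mathcal A$. A class $\mathcal C$ of connected graphs is bridge-stable if (a) for any two disjoint graphs both in $\mathcal C$, the graph formed from their union by adding any edge between them is in $\mathcal C$, and (b) for any two disjoint graphs exactly one of which is in $\mathcal C$, the graph formed by adding any edge between them is not in $\mathcal C$. $\kappa(G,\mathcal C)$ is the number of components of $G$ in $\mathcal C$; $\kappa^+(G,\mathcal C)=\kappa(G,\mathcal C)$ if every component of $G$ is in $\mathcal C$, and $\kappa(G,\mathcal C)+1$ otherwise. $\operatorname{Frag}(G)$ is obtained from $G$ by deleting a largest component; $\operatorname{frag}(G,\mathcal C)$ is the number of vertices in the components of $\operatorname{Frag}(G)$ lying in $\mathcal C$. $X$ is stochastically dominated by $Y$ if $\mathbb P(X>t)\le\mathbb P(Y>t)$ for all $t$. *)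

(* Defs.v *)
From HB Require Import structures.
From mathcomp Require Import all_boot all_order all_algebra.
From mathcomp Require Import all_classical all_reals all_analysis.
Set Implicit Arguments. Unset Strict Implicit. Unset Printing Implicit Defensive.
Import Order.TTheory GRing.Theory Num.Theory.

(* A (simple) graph with vertex set the whole finite type T is an edge set
   E : {set T * T} that is symmetric and irreflexive. *)
Definition graph (T : finType) := {set T * T}.

Definition is_graph (T : finType) (G : graph T) : bool :=
  [forall x : T, forall y : T, ((x, y) \in G) == ((y, x) \in G)] &&
  [forall x : T, (x, x) \notin G].

Definition gclass := forall T : finType, graph T -> Prop.

Definition adj (T : finType) (G : graph T) : rel T := fun x y => (x, y) \in G.

Definition giso (T T' : finType) (G : graph T) (G' : graph T') : Prop :=
  exists f : T -> T', bijective f /\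
    forall x y : T, ((x, y) \in G) = ((f x, f y) \in G').

Definition iso_closed (A : gclass) : Prop :=
  forall (T T' : finType) (G : graph T) (G' : graph T'),
    is_graph G -> giso G G' -> A T G -> A T' G'.

Definition vsub (T : finType) (S : {set T}) : finType := {x : T | x \in S}.

Definition induced (T : finType) (G : graph T) (S : {set T}) : graph (vsub S) :=
  [set p : vsub S * vsub S | (val p.1, val p.2) \in G].

Definition add_edge (T : finType) (G : graph T) (u v : T) : graph T :=
  G :|: [set (u, v); (v, u)].

Definition gconnected (T : finType) (G : graph T) : Prop :=
  0 < #|T| /\ forall x y : T, connect (adj G) x y.

Definition components (T : finType) (G : graph T) : {set {set T}} :=
  [set [set y | connect (adj G) x y] | x : T].

Definition bridge_addable (A : gclass) (TH : finType) (H : graph TH) : Prop :=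
  forall (T : finType) (G : graph T) (K : {set T}) (u v : T),
    is_graph G -> A T G -> K \in components G -> giso (induced G K) H ->
    u \in K -> v \notin K -> A T (add_edge G u v).

(* bridge-stability; two disjoint graphs are modelled as the induced graphs on
   S and ~: S of a graph G with no edge between S and ~: S *)
Definition bridge_stable (C : gclass) : Prop :=
  forall (T : finType) (G : graph T) (S : {set T}) (u v : T),
    is_graph G ->
    (forall x y, x \in S -> y \notin S -> (x, y) \notin G) ->
    u \in S -> v \notin S ->
    (C _ (induced G S) -> C _ (induced G (~: S)) -> C T (add_edge G u v)) /\
    (~ (C _ (induced G S) <-> C _ (induced G (~: S))) -> ~ C T (add_edge G u v)).

Definition compsC (C : gclass) (T : finType) (G : graph T) : {set {set T}} :=
  [set K in components G | `[< C _ (induced G K) >]].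

Definition kappa (C : gclass) (T : finType) (G : graph T) : nat := #|compsC C G|.

Definition kappa_plus (C : gclass) (T : finType) (G : graph T) : nat :=
  if components G \subset compsC C G then kappa C G else (kappa C G).+1.

(* frag(G, C), given the largest component L removed to form Frag(G) *)
Definition frag (C : gclass) (T : finType) (G : graph T) (L : {set T}) : nat :=
  \sum_(K in compsC C G | K != L) #|K|.

Definition An (A : gclass) (n : nat) : {set graph 'I_n} :=
  [set G : graph 'I_n | is_graph G && `[< A _ G >]].

(* Main.v *)
(** Call a pair of vertices of [G] crossing if they lie in different components,
at least one of which is in [C]. Adding a crossing edge keeps a graph in [A] and
creates a bridge, from which (with the new graph) the old graph is recovered;
a graph on [n] vertices with [c] components has at most [n - c] bridges.

Lump the vertices outside the components in [C] into a single part; then [G] has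
[kappa_plus C G] parts and an edge is crossing iff it joins two parts. By
bridge-stability adding it merges these two parts. A graph with [k + 1] parts has at
least [k (n - k)] crossing edges, so comparing with the at most [n - k] bridges of a
graph with [k] parts gives [a (k + 1) * k <= a k] for the number [a k] of graphs with
[k] parts. Thus [a (k + 1) * k!] is nonincreasing, which is domination by [1 + Po(1)]
in the likelihood ratio order.

Every vertex is in at least [frag C G L] crossing edges, so the number of crossing
edges is at least [n * frag C G L / 2], and it is at most [n - 1] on average. *)

Require Import Defs.
From HB Require Import structures.
From mathcomp Require Import all_boot all_order all_algebra.
From mathcomp Require Import all_classical all_reals all_analysis.
From mathcomp Require Import zify lra.
Import Order.TTheory GRing.Theory Num.Theory.
Local Open Scope ring_scope.

Set Implicit Arguments.
Unset Strict Implicit.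
Unset Printing Implicit Defensive.

(** * Cardinals of images and kernels *)

Section Kernels.
Local Open Scope nat_scope.

(** On [S] the map [f'] factors through [f]: the set [P] of pairs [(f x, f' x)] projects injectively
    to the first coordinate, and its second projection is [f' @: S]. *)
Lemma leq_card_imset_ker (T U U' : finType) (f : T -> U) (f' : T -> U')
    (S : {set T}) :
  {in S &, forall x y, f x = f y -> f' x = f' y} -> #|f' @: S| <= #|f @: S|.
Proof.
move=> ff'; pose P := [set (f x, f' x) | x in S].
have -> : f' @: S = snd @: P by rewrite -imset_comp; apply: eq_imset.
have -> : f @: S = fst @: P by rewrite -imset_comp; apply: eq_imset.
rewrite [X in _ <= X]card_in_imset ?leq_imset_card // => p q.
by move=> /imsetP[x xS ->] /imsetP[y yS ->] /= fxy; rewrite fxy (ff' x y).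
Qed.

(** Dropping the fibre of [f u] costs [f] one value and [f'] none, since [v] still represents the
    merged class; on the remaining points the kernels agree. Used both for components and for
    parts. *)
Lemma card_imset_merge (T U U' : finType) (f : T -> U) (f' : T -> U') (u v : T) :
  f u != f v ->
  (forall x y, (f' x == f' y) =
    (f x == f y) || (f x \in [set f u; f v]) && (f y \in [set f u; f v])) ->
  #|f @: [set: T]| = #|f' @: [set: T]|.+1.
Proof.
move=> fuv ker; pose S := [set x | f x != f u].
have kerS : {in S &, forall x y, (f' x == f' y) = (f x == f y)}.
  move=> x y; rewrite !inE ker !inE => /negPf-> /negPf->/=.
  by apply/orb_idr => /andP[/eqP-> /eqP->].
have -> : f @: [set: T] = f u |: f @: S.
  apply/setP => z; rewrite !inE; apply/imsetP/idP => [[x _ ->]|].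
    by case: eqVneq => //= xu; apply/imsetP; exists x; rewrite ?inE.
  by case/orP => [/eqP->|/imsetP[x _ ->]]; [exists u | exists x].
have -> : f' @: [set: T] = f' @: S.
  apply/setP => z; apply/imsetP/imsetP => -[x xS ->]; last by exists x.
  case: (boolP (x \in S)) => [xS'|]; first by exists x.
  rewrite inE negbK => /eqP fxu; exists v; first by rewrite inE eq_sym.
  by apply/eqP; rewrite ker fxu set21 set22 orbT.
have -> : #|f' @: S| = #|f @: S|.
  apply/eqP; rewrite eqn_leq; apply/andP; split; apply: leq_card_imset_ker.
    by move=> x y xS yS /eqP; rewrite -kerS // => /eqP.
  by move=> x y xS yS /eqP; rewrite kerS // => /eqP.
suff /negPf fuS : f u \notin f @: S by rewrite cardsU1 fuS.
by apply/imsetP => -[x]; rewrite inE => /eqP xu /esym.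
Qed.

Lemma sum_card_fiber (T U : finType) (f : T -> U) :
  \sum_(z in f @: [set: T]) #|[set x | f x == z]| = #|T|.
Proof.
rewrite -sum1_card (partition_big f (mem (f @: [set: T]))) /=; last first.
  by move=> x _; apply: imset_f; rewrite inE.
by apply: eq_bigr => z _; rewrite -sum1_card; apply: eq_bigl => x; rewrite inE.
Qed.

Lemma sum_card_dep (I J : finType) (S : {set I}) (F : I -> {set J}) :
  \sum_(i in S) #|F i| = #|[set p : I * J | (p.1 \in S) && (p.2 \in F p.1)]|.
Proof.
rewrite -sum1_card [RHS](eq_bigl (fun p => (p.1 \in S) && (p.2 \in F p.1))).
  rewrite -(pair_big_dep (mem S) (fun i j => j \in F i) (fun _ _ => 1)) /=.
  by apply: eq_bigr => i _; rewrite sum1_card.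
by move=> p; rewrite inE.
Qed.

Lemma card_pairs (T : finType) (r : rel T) :
  #|[set p : T * T | r p.1 p.2]| = \sum_x #|[set y | r x y]|.
Proof.
transitivity (\sum_(x in [set: T]) #|[set y | r x y]|); last first.
  by apply: eq_bigl => x; rewrite inE.
by rewrite sum_card_dep; apply: eq_card => p; rewrite !inE.
Qed.

Lemma card_cross_ge (T U : finType) (f : T -> U) (k : nat) :
  #|f @: [set: T]| = k.+1 ->
  2 * (k * (#|T| - k)) <= #|[set p : T * T | f p.1 != f p.2]|.
Proof.
move=> imk; case: (posnP k) => [->//|k0]; set n := #|T|.
pose a z := #|[set x | f x == z]|.
have suma : \sum_(z in f @: [set: T]) a z = n by exact: sum_card_fiber.
have a0 z : z \in f @: [set: T] -> 0 < a z.
  by move=> /imsetP[x _ ->]; apply/card_gt0P; exists x; rewrite inE.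
have an z : z \in f @: [set: T] -> a z + k <= n.
  move=> zim; rewrite -suma (bigD1 z) //= leq_add2l.
  have -> : k = #|f @: [set: T] :\ z| by move: imk; rewrite (cardsD1 z) zim => -[].
  rewrite -sum1_card (eq_bigl (fun i => (i \in f @: [set: T]) && (i != z))).
    by apply: leq_sum => i /andP[iim _]; apply: a0.
  by move=> i; rewrite !inE andbC.
have -> : #|[set p : T * T | f p.1 != f p.2]| =
    \sum_(z in f @: [set: T]) a z * (n - a z).
  rewrite (card_pairs (fun x y => f x != f y)).
  rewrite (partition_big f (mem (f @: [set: T]))) /=; last first.
    by move=> x _; apply: imset_f; rewrite inE.
  apply: eq_bigr => z _; rewrite /a -sum_nat_const.
  rewrite [RHS](eq_bigl (fun x => f x == z)); last by move=> x; rewrite inE.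
  apply: eq_bigr => x /eqP xz; rewrite cardsCs; congr (_ - #|pred_of_set _|).
  by apply/setP => y; rewrite !inE negbK xz eq_sym.
(* Since [1 <= a z <= n - k], the product [(a z - 1) * (n - k - a z)] is nonnegative; this is its
   expansion. Summing over the [k + 1] values gives the lower bound [k * (2 * n - k - 1)], which
   suffices because [k > 0]. *)
have lek z : z \in f @: [set: T] ->
    (n - k) + a z * k <= a z * (n - a z) + a z.
  move=> zim; have := a0 z zim; have := an z zim.
  move: (a z) => b bk b0; have [m ->] : exists m, n = b + k + m by exists (n - (b + k)); lia.
  have -> : b + k + m - k = b + m by lia.
  have -> : b + k + m - b = k + m by lia.
  nia.
have := leq_sum (index_enum U) (fun z => lek z).
rewrite !big_split /= sum_nat_const imk -big_distrl /= suma.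
have : k.+1 <= n.
  have [z zim] : exists z, z \in f @: [set: T] by apply/card_gt0P; rewrite imk.
  by have := a0 z zim; have := an z zim; lia.
move: (\sum_(z in _) _) => X kn.
have [m ->] : exists m, n = k.+1 + m by exists (n - k.+1); lia.
have -> : k.+1 + m - k = m.+1 by lia.
nia.
Qed.

End Kernels.

(** * Components and bridges *)

Section Components.
Import mathcomp.boot.fintype mathcomp.boot.finset.
Local Open Scope nat_scope.
Variable T : finType.
Implicit Types G : graph T.

Definition comp_of G x : {set T} := [set y | connect (adj G) x y].

Definition del_edge G (u v : T) : graph T := G :\: [set (u, v); (v, u)].

(** Like [cross] below, this consists of ordered pairs, so each bridge of a graph counts twice;
    hence the factors 2 in the counts. *)
Definition bridges G : {set T * T} :=
  [set p in G | ~~ connect (adj (del_edge G p.1 p.2)) p.1 p.2].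

Lemma componentsE G : components G = comp_of G @: [set: T].
Proof. by apply/setP => K; apply/imsetP/imsetP => -[x _ ->]; exists x. Qed.

Lemma graph_sym G : is_graph G -> symmetric (adj G).
Proof. by move=> /andP[/forallP gs _] x y; have /forallP/(_ y)/eqP := gs x. Qed.

Lemma graph_irr G x : is_graph G -> (x, x) \in G = false.
Proof. by move=> /andP[_ /forallP/(_ x)/negPf]. Qed.

Lemma is_graphI G :
  (forall x y, (x, y) \in G = ((y, x) \in G)) ->
  (forall x, (x, x) \notin G) -> is_graph G.
Proof.
move=> gs gi; apply/andP; split; last exact/forallP.
by apply/forallP => x; apply/forallP => y; rewrite gs.
Qed.

Lemma add_edgeC G u v : add_edge G u v = add_edge G v u.
Proof. by rewrite /add_edge (setUC [set (v, u)]). Qed.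

Lemma swap_eq (x y u v : T) : ((x, y) == (u, v)) = ((y, x) == (v, u)).
Proof. by rewrite !xpair_eqE andbC. Qed.

Lemma is_graph_add G u v : is_graph G -> u != v -> is_graph (add_edge G u v).
Proof.
move=> gG uv; apply: is_graphI => [x y|x]; rewrite !inE.
  rewrite -!/(adj G _ _) graph_sym //; congr (_ || _).
  by rewrite (swap_eq x y) (swap_eq x y v) orbC.
rewrite graph_irr //= !xpair_eqE.
by case: (eqVneq x u) => [->|_] //=; rewrite ?(negPf uv) ?andbF.
Qed.

Lemma is_graph_del G u v : is_graph G -> is_graph (del_edge G u v).
Proof.
move=> gG; apply: is_graphI => [x y|x]; rewrite !inE ?graph_irr ?andbF //.
rewrite -!/(adj G _ _) graph_sym //; congr (~~ _ && _).
by rewrite (swap_eq x y) (swap_eq x y v) orbC.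
Qed.

Lemma add_edgeK G u v : is_graph G -> (u, v) \notin G ->
  del_edge (add_edge G u v) u v = G.
Proof.
move=> gG uv; rewrite /del_edge setDUl setDv setU0; apply/setDidPl.
rewrite disjoint_sym disjoints_subset subUset !sub1set !inE uv /=.
by rewrite -/(adj G v u) graph_sym.
Qed.

Lemma del_edgeK G u v : is_graph G -> (u, v) \in G ->
  add_edge (del_edge G u v) u v = G.
Proof.
move=> gG uv; rewrite /add_edge /del_edge -[RHS](setID G [set (u, v); (v, u)]) setUC.
congr (_ :|: _); apply/esym/setIidPr.
by rewrite subUset !sub1set uv -/(adj G v u) graph_sym.
Qed.

Section Graph.
Variable G : graph T.
Hypothesis gG : is_graph G.

Lemma connectC : connect_sym (adj G).
Proof. exact/sym_connect_sym/graph_sym. Qed.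

Lemma eq_comp_of x y : (comp_of G x == comp_of G y) = connect (adj G) x y.
Proof.
apply/eqP/idP => [/setP/(_ y)|xy]; first by rewrite !inE connect0.
by apply/setP => z; rewrite !inE (same_connect connectC xy).
Qed.

Lemma in_comp_of x y : (y \in comp_of G x) = (comp_of G y == comp_of G x).
Proof. by rewrite inE eq_comp_of connectC. Qed.

Lemma mem_components K x : K \in components G -> x \in K -> K = comp_of G x.
Proof.
rewrite componentsE => /imsetP[y _ ->].
by rewrite in_comp_of => /eqP.
Qed.

Section Merge.
Variables u v : T.
Let W := comp_of G u :|: comp_of G v.

(** A path through the new edge starts and ends in the old component of [u] or of [v], that is, in
    [W]; conversely the new edge links all of [W]. *)
Lemma connect_add_edge x y :
  connect (adj (add_edge G u v)) x y =
    connect (adj G) x y || (x \in W) && (y \in W).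
Proof.
have inW a b : connect (adj G) a b -> (a \in W) = (b \in W).
  by move=> ab; rewrite !in_setU !in_comp_of; move/eqP: (etrans (eq_comp_of a b) ab) => ->.
have sub : subrel (connect (adj G)) (connect (adj (add_edge G u v))).
  by apply: connect_sub => a b ab; apply: connect1; rewrite /adj inE; apply/orP; left.
have cuv : connect (adj (add_edge G u v)) u v.
  by apply: connect1; rewrite /adj !inE eqxx orbT.
have cvu : connect (adj (add_edge G u v)) v u.
  by apply: connect1; rewrite /adj !inE eqxx !orbT.
apply/idP/idP; last first.
  case/orP => [/sub//|/andP[]]; rewrite !inE.
  by case/orP; rewrite connectC => /sub ux; case/orP => /sub yv;
    apply: (connect_trans ux) => //; apply: connect_trans yv.
case/connectP => p; elim: p x => [x _ ->|z p IHp x /= /andP[xz pz] py].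
  by rewrite connect0.
have {IHp} IH := IHp z pz py; move: xz.
have -> : adj (add_edge G u v) x z =
    [|| (x, z) \in G, (x, z) == (u, v) | (x, z) == (v, u)] by rewrite /adj !inE.
case/orP => [/(@connect1 _ (adj G)) xz|].
  by rewrite (inW _ _ xz) (same_connect connectC xz).
have uW : u \in W by rewrite !inE connect0.
have vW : v \in W by rewrite !inE connect0 orbT.
have yW : z \in W -> y \in W.
  by move=> zW; case/orP: IH => [/inW <-//|/andP[]].
by case/orP => /eqP[-> zE]; rewrite yW ?uW ?vW ?orbT // zE.
Qed.

Lemma comp_add_edge x :
  comp_of (add_edge G u v) x = if x \in W then W else comp_of G x.
Proof.
apply/setP => y; rewrite inE connect_add_edge.
case: ifPn => xW; last by rewrite /= orbF inE.
rewrite andTb; apply/orb_idl => xy; move: xW; rewrite !in_setU !in_comp_of.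
by move/eqP: (etrans (eq_comp_of x y) xy) => ->.
Qed.

End Merge.
End Graph.

Lemma card_components_add G u v : is_graph G -> ~~ connect (adj G) u v ->
  #|components G| = #|components (add_edge G u v)|.+1.
Proof.
move=> gG uv; rewrite !componentsE; apply: (card_imset_merge (u := u) (v := v)).
  by rewrite eq_comp_of.
have gG' : is_graph (add_edge G u v).
  by apply: is_graph_add => //; apply: contraNneq uv => ->.
by move=> x y; rewrite !eq_comp_of // connect_add_edge // !in_setU !in_comp_of // !in_set1.
Qed.

Lemma mem_bridges_add G u v : is_graph G -> ~~ connect (adj G) u v ->
  (u, v) \in bridges (add_edge G u v).
Proof.
move=> gG uv; rewrite inE /= add_edgeK ?uv //; last first.
  by apply: contra uv => uvG; exact: (@connect1 _ (adj G)).
by rewrite !inE eqxx orbT.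
Qed.

(** Induction on the number of edges: deleting a bridge creates one more component, worth 2 here,
    and costs at most the two ordered pairs of that bridge. *)
Lemma card_bridges G : is_graph G ->
  #|bridges G| + 2 * #|components G| <= 2 * #|T|.
Proof.
have [m] := ubnP #|G|; elim: m => // m IHm in G *; rewrite ltnS => Gm gG.
case: (set_0Vmem (bridges G)) => [->|[[u v]]].
  by rewrite cards0 add0n leq_mul2l /= componentsE (leq_trans (leq_imset_card _ _)) // cardsT.
rewrite inE /= => /andP[uvG ncuv]; set G0 := del_edge G u v in ncuv *.
have gG0 : is_graph G0 by exact: is_graph_del.
have G0m : #|G0| < m.
  apply: leq_trans Gm; apply: proper_card; apply/properP; split.
    exact: subsetDl.
  by exists (u, v) => //; rewrite !inE eqxx.
have := IHm G0 G0m gG0; rewrite (card_components_add gG0 ncuv) del_edgeK //.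
apply: leq_trans; rewrite mulnS addnA leq_add2r.
(* The other bridges survive, because deleting edges never connects more vertices. *)
have sub : bridges G \subset bridges G0 :|: [set (u, v); (v, u)].
  apply/subsetP => -[x y]; rewrite [in X in X -> _]inE /= => /andP[xyG ncxy].
  rewrite in_setU orbC; case: (boolP (_ \in [set _; _])) => //= xyuv.
  rewrite inE /= in_setD xyuv xyG /=; apply: contra ncxy.
  apply: connect_sub => a b; rewrite /adj => ab; apply: connect1.
  by move: ab; rewrite /adj !inE => /and3P[-> _ ->].
apply: leq_trans (subset_leq_card sub) _.
rewrite (leq_trans (leq_card_setU _ _)) // leq_add2l cards2.
by case: (_ != _).
Qed.

End Components.

(** * Classes of connected graphs *)

(* MathComp-Analysis has another constant of this name. *)
Local Notation induced := Defs.induced.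

Section Isomorphism.
Local Open Scope nat_scope.
Import mathcomp.boot.fintype mathcomp.boot.finset.

Lemma giso_refl (T : finType) (G : graph T) : giso G G.
Proof. by exists id; split => //; exists id. Qed.

Lemma giso_sym (T T' : finType) (G : graph T) (G' : graph T') :
  giso G G' -> giso G' G.
Proof.
move=> [f [[g fK gK] fG]]; exists g; split; first by exists f.
by move=> x y; rewrite fG !gK.
Qed.

Lemma induced_is_graph (T : finType) (G : graph T) (S : {set T}) :
  is_graph G -> is_graph (induced G S).
Proof.
move=> gG; apply: is_graphI => [x y|x]; rewrite !inE /= ?graph_irr //.
exact: (graph_sym gG).
Qed.

(** [bridge_stable] requires the two sides to fill the whole vertex type, so it is applied on
    [vsub W]; this isomorphism carries membership in [C] between [G] and that smaller graph. *)
Lemma giso_induced_induced (T : finType) (G : graph T) (W K : {set T}) :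
  K \subset W ->
  giso (induced G K) (induced (induced G W) [set x : vsub W | val x \in K]).
Proof.
move=> /subsetP KW; set S := [set x | _].
have inS (x : vsub K) : exist _ (val x) (KW _ (valP x)) \in S.
  by rewrite inE; exact: (valP x).
have inK (y : vsub S) : val (val y) \in K.
  by have := valP y; rewrite inE.
exists (fun x : vsub K => exist (fun y => y \in S) _ (inS x) : vsub S); split.
  exists (fun y : vsub S => exist (fun x => x \in K) _ (inK y) : vsub K).
    by move=> x; apply: val_inj.
  by move=> y; do 2 apply: val_inj.
by move=> x y; rewrite !inE.
Qed.

End Isomorphism.

Section Class.
Local Open Scope nat_scope.
Import mathcomp.boot.fintype mathcomp.boot.finset.
Variable C : gclass.
Variable T : finType.
Implicit Types (G : graph T) (K : {set T}).

Definition inC G K : bool := `[< C (induced G K) >].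

(** [None] is the single part lumping all vertices outside the components in [C]. *)
Definition part G x : option {set T} :=
  if inC G (comp_of G x) then Some (comp_of G x) else None.

Definition cross G : {set T * T} := [set p | part G p.1 != part G p.2].

Lemma mem_compsC G x : (comp_of G x \in compsC C G) = inC G (comp_of G x).
Proof. by rewrite inE componentsE imset_f ?inE. Qed.

(** The value [None] is taken exactly when some component is not in [C], and accounts for the extra
    1 in [kappa_plus]. *)
Lemma kappa_plusE G : kappa_plus C G = #|part G @: [set: T]|.
Proof.
have someC : #|Some @: compsC C G| = kappa C G by apply: card_imset => ? ? [].
have mem_someC x : inC G (comp_of G x) = (part G x \in Some @: compsC C G).
  rewrite /part; case: ifPn => xC; last by apply/esym/imsetP => -[].
  by apply/esym/imsetP; exists (comp_of G x); rewrite ?mem_compsC.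
have sub : Some @: compsC C G \subset part G @: [set: T].
  apply/subsetP => _ /imsetP[K KC ->]; have := KC.
  rewrite inE componentsE => /andP[/imsetP[x _ KE] _].
  by apply/imsetP; exists x => //; rewrite /part -mem_compsC -KE KC.
rewrite /kappa_plus -someC; case: ifPn => [/subsetP allC|nallC].
  apply: eq_card => z; apply/idP/idP => [/(subsetP sub)//|/imsetP[x _ ->]].
  by rewrite -mem_someC -mem_compsC allC // componentsE imset_f ?inE.
have -> : part G @: [set: T] = None |: Some @: compsC C G.
  apply/eqP; rewrite eqEsubset subUset sub sub1set !andbT.
  have [K Kcomp KC] := subsetPn nallC.
  move: Kcomp KC; rewrite componentsE => /imsetP[y _ ->]; rewrite mem_compsC => yC.
  apply/andP; split; last by apply/imsetP; exists y; rewrite // /part (negPf yC).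
  apply/subsetP => _ /imsetP[x _ ->]; rewrite in_setU1 -mem_someC /part.
  by case: ifP.
by rewrite cardsU1; case: imsetP => // -[].
Qed.

Section Graph.
Variable G : graph T.
Hypothesis gG : is_graph G.

Lemma inC_connect x y : connect (adj G) x y ->
  inC G (comp_of G x) = inC G (comp_of G y).
Proof. by rewrite -eq_comp_of // => /eqP->. Qed.

Lemma eq_part x y : (part G x == part G y) =
  connect (adj G) x y || ~~ inC G (comp_of G x) && ~~ inC G (comp_of G y).
Proof.
rewrite /part -eq_comp_of //; case: ifPn => xC; case: ifPn => yC /=; rewrite ?orbF ?orbT //.
- by symmetry; apply: contraNF yC => /eqP <-.
- by symmetry; apply: contraNF xC => /eqP ->.
Qed.

Lemma kappa_plus_le_components : kappa_plus C G <= #|components G|.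
Proof.
rewrite kappa_plusE componentsE; apply: leq_card_imset_ker => x y _ _ xy.
by rewrite /part xy.
Qed.

Lemma kappa_plus_gt0 : 0 < #|T| -> 0 < kappa_plus C G.
Proof.
case/card_gt0P => x _; rewrite kappa_plusE; apply/card_gt0P; exists (part G x).
exact: imset_f.
Qed.

Lemma fragE L : L \in components G ->
  frag C G L = #|[set x | inC G (comp_of G x) && (comp_of G x != L)]|.
Proof.
move=> Lcomp; rewrite /frag -sum1_card.
rewrite (partition_big (comp_of G) (fun K => (K \in compsC C G) && (K != L))) /=.
  apply: eq_bigr => K /andP[KC KL]; rewrite -sum1_card; apply: eq_bigl => x.
  have /andP[Kcomp _] : (K \in components G) && inC G K by move: KC; rewrite inE.
  rewrite inE; apply/idP/idP => [xK|/andP[_ /eqP <-]]; last by rewrite inE connect0.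
  by rewrite -mem_compsC -(mem_components gG Kcomp xK) KC KL eqxx.
by move=> x; rewrite inE mem_compsC.
Qed.

(** If the component of [x] is not in [C], then [x] crosses to every vertex counted by [frag].
    Otherwise it crosses to everything outside its own component; as [L] is largest, that is at
    least the number of vertices outside [L], among which are those counted by [frag]. *)
Lemma frag_cross L : L \in components G ->
  (forall K, K \in components G -> #|K| <= #|L|) ->
  #|T| * frag C G L <= #|cross G|.
Proof.
move=> Lcomp Lmax; rewrite fragE //; set F := [set x | _].
rewrite (card_pairs (fun x y => part G x != part G y)) -sum_nat_const.
apply: leq_sum => x _; case: (boolP (inC G (comp_of G x))) => xC; last first.
  apply/subset_leq_card/subsetP => y; rewrite !inE => /andP[yC _].
  by rewrite eq_part yC andbF orbF; apply: contraNN xC => /inC_connect->.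
apply: (@leq_trans #|~: L|).
  apply/subset_leq_card/subsetP => y; rewrite !inE => /andP[_].
  by apply: contraNN => /(mem_components gG Lcomp) ->.
apply: (@leq_trans #|~: comp_of G x|).
  rewrite [#|~: L|]cardsCs [#|~: comp_of G x|]cardsCs !setCK leq_sub2l // Lmax //.
  by rewrite componentsE imset_f ?inE.
apply/subset_leq_card/subsetP => y; rewrite in_setC in_comp_of // => xy.
by rewrite inE eq_part xC orbF -eq_comp_of // eq_sym.
Qed.

End Graph.

(** The map [h] adds the edge and keeps the pair, so deleting the pair inverts it. Applied to two
    consecutive levels, and to all of [An] against itself. *)
Lemma sum_cross_le_bridges (S S' : {set graph T}) :
  (forall G, G \in S -> is_graph G) ->
  (forall G u v, G \in S -> part G u != part G v -> add_edge G u v \in S') ->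
  \sum_(G in S) #|cross G| <= \sum_(G in S') #|bridges G|.
Proof.
move=> gS addS; rewrite !sum_card_dep.
set X := [set p | _]; set Y := [set p | _].
pose h (q : graph T * (T * T)) := (add_edge q.1 q.2.1 q.2.2, q.2).
have nc G u v : G \in S -> (u, v) \in cross G -> ~~ connect (adj G) u v.
  by move=> GS; rewrite inE /= eq_part ?gS // negb_or => /andP[].
have nG G u v : G \in S -> (u, v) \in cross G -> (u, v) \notin G.
  by move=> GS /(nc _ _ _ GS); apply: contra => uvG; exact: (@connect1 _ (adj G)).
have hX : {in X &, injective h}.
  move=> [G [u v]] [G' [u' v']]; rewrite !inE /= => /andP[GS uv] /andP[GS' uv'].
  case=> addE ? ?; subst u' v'; congr (_, _).
  rewrite -(add_edgeK (gS _ GS) (u := u) (v := v)); last by apply: nG; rewrite ?inE.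
  by rewrite addE add_edgeK ?gS //; apply: nG; rewrite ?inE.
rewrite -(card_in_imset hX); apply/subset_leq_card/subsetP => q.
case/imsetP => -[G [u v]]; rewrite inE /= => /andP[GS uv] ->; rewrite inE /= addS //=; last by move: uv; rewrite inE.
by rewrite mem_bridges_add ?gS ?nc.
Qed.

End Class.

(** * Bridge-stability and the merging of parts *)

Section BridgeStable.
Local Open Scope nat_scope.
Import mathcomp.boot.fintype mathcomp.boot.finset.
Variable C : gclass.
Hypotheses (isoC : iso_closed C) (stableC : bridge_stable C).
Variables (T : finType) (G : graph T).
Hypothesis gG : is_graph G.

Lemma inC_add_edge u v (K : {set T}) : u \notin K -> v \notin K ->
  inC C (add_edge G u v) K = inC C G K.
Proof.
move=> uK vK; congr (`[< _ >]); congr (C _); apply/setP => -[x y].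
rewrite !inE /= !xpair_eqE; case: eqVneq => [xu|_] /=.
  by case/negP: uK; rewrite -xu; exact: (valP x).
case: eqVneq => [xv|_]; last by rewrite orbF.
by case/negP: vK; rewrite -xv; exact: (valP x).
Qed.

Lemma inC_induced_induced (W K : {set T}) : K \subset W ->
  inC C G K <-> C (induced (induced G W) [set x : vsub W | val x \in K]).
Proof.
move=> KW; have iso := giso_induced_induced G KW.
split=> [/asboolP|CK]; first by apply: isoC iso; exact: induced_is_graph.
by apply/asboolP; apply: isoC (giso_sym iso) CK; do 2 apply: induced_is_graph.
Qed.

(** With [K] in [C], clause (a) of bridge-stability gives one direction of the equality and clause
    (b) the other. *)
Lemma inC_merge u v (K K' : {set T}) : u \in K -> v \in K' -> [disjoint K & K'] ->
  (forall x y, x \in K -> y \in K' -> (x, y) \notin G) ->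
  inC C G K -> inC C (add_edge G u v) (K :|: K') = inC C G K'.
Proof.
move=> uK vK' KK' noedge KC; set W := K :|: K'.
have uW : u \in W by rewrite inE uK.
have vW : v \in W by rewrite inE vK' orbT.
pose u0 : vsub W := exist _ u uW; pose v0 : vsub W := exist _ v vW.
pose G0 := induced G W; pose S := [set x : vsub W | val x \in K].
have addE : induced (add_edge G u v) W = add_edge G0 u0 v0.
  by apply/setP => -[x y]; rewrite !inE /= !xpair_eqE.
have SCE : ~: S = [set x : vsub W | val x \in K'].
  apply/setP => x; have := valP x; rewrite !inE.
  by case: (boolP (val x \in K)) => [xK _|_ /= ->//]; rewrite (disjointFr KK' xK).
have /(_ G0 S u0 v0)[] := stableC (T := vsub W).
- exact: induced_is_graph.
- move=> x y; rewrite !inE /= => xK; have := valP y; rewrite inE.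
  by case: (boolP (val y \in K)) => //= _ yK' _; apply: noedge.
- by rewrite inE.
- by rewrite inE /= (disjointFl KK' vK').
rewrite SCE => stab1 stab2.
have KS := (inC_induced_induced (subsetUl K K')).1 KC.
have K'S := inC_induced_induced (subsetUr K K').
rewrite [LHS]/inC addE; apply/asboolP/idP => [CG0|K'C]; last first.
  by apply: stab1 => //; apply/K'S.
apply/negP => /negP nK'C; apply: stab2 CG0 => -[h _].
by move/negP: nK'C; apply; apply/K'S/h.
Qed.

Section Merge.
Variables u v : T.
Hypothesis uv : ~~ connect (adj G) u v.

(** The merged component is in [C] exactly when that of [v] was, so [v] stands in for every vertex
    of it. *)
Lemma inC_comp_add_edge x : inC C G (comp_of G u) ->
  inC C (add_edge G u v) (comp_of (add_edge G u v) x) =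
  inC C G (comp_of G (if x \in comp_of G u :|: comp_of G v then v else x)).
Proof.
move=> uC; rewrite comp_add_edge //; case: ifPn => xW.
  apply: inC_merge => //; rewrite ?inE ?connect0 //.
    apply/pred0P => y /=; rewrite !in_comp_of //; apply/negP => /andP[/eqP-> /eqP/eqP].
    by rewrite eq_comp_of // (negPf uv).
  move=> y z; rewrite !inE => uy vz; apply: contra uv => yz.
  apply: connect_trans uy _; rewrite connectC //; apply: connect_trans vz _.
  by rewrite connectC //; exact: (@connect1 _ (adj G)).
by move: xW; rewrite !inE negb_or => /andP[ux vx]; rewrite inC_add_edge // !inE connectC.
Qed.

End Merge.

(** Say the component of [u] is in [C]. If that of [v] is too, two [Some] parts become one; if not,
    the part of [u] is absorbed into [None]. *)
Lemma kappa_plus_add_edge u v : part C G u != part C G v ->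
  kappa_plus C G = (kappa_plus C (add_edge G u v)).+1.
Proof.
(* Distinct parts are not both [None], so some endpoint has its component in [C], and the edge may
   be read in either direction. *)
wlog uC : u v / inC C G (comp_of G u).
  move=> IH uv; case: (boolP (inC C G (comp_of G u))) => [|nuC]; first by move/IH; apply.
  rewrite add_edgeC; apply: IH; last by rewrite eq_sym.
  by move: uv; rewrite eq_part // nuC /= negb_or negbK => /andP[].
move=> puv; have := puv; rewrite eq_part // uC /= orbF => uv.
have gG' : is_graph (add_edge G u v).
  by apply: is_graph_add => //; apply: contraNneq uv => ->.
rewrite !kappa_plusE; apply: card_imset_merge puv _ => x y.
pose w z := z \in comp_of G u :|: comp_of G v.
have part_uv z : (part C G z \in [set part C G u; part C G v]) =
    w z || ~~ inC C G (comp_of G z) && ~~ inC C G (comp_of G v).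
  by rewrite /w !inE !eq_part // uC andbF orbF -orbA !(connectC gG z).
(* If both merged components are in [C], so is that of every vertex in them. With this, the kernel
   condition is a check over six Booleans. *)
have wC z : w z ==> inC C G (comp_of G v) ==> inC C G (comp_of G z).
  apply/implyP; rewrite /w !inE => /orP[] /(inC_connect C gG) <-.
    by rewrite uC implybT.
  exact: implybb.
rewrite !part_uv !eq_part // !inC_comp_add_edge // connect_add_edge //.
rewrite -/(w x) -/(w y) !(fun_if (comp_of G)) !(fun_if (inC C G)).
move: (wC x) (wC y); move: (inC C G _) (inC C G _) (inC C G _) (w x) (w y) (connect _ _ _).
by do 6 case.
Qed.

End BridgeStable.

(** * Counting *)

Section Counting.
Local Open Scope nat_scope.
Import mathcomp.boot.fintype mathcomp.boot.finset.
Variables A C : gclass.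
Hypotheses (isoC : iso_closed C) (stableC : bridge_stable C).
Hypothesis addC : forall (T : finType) (H : graph T),
  is_graph H -> C H -> bridge_addable A H.

Lemma class_add_cross (T : finType) (G : graph T) u v :
  is_graph G -> A G -> part C G u != part C G v -> A (add_edge G u v).
Proof.
move=> gG AG; wlog uC : u v / inC C G (comp_of G u).
  move=> IH uv; case: (boolP (inC C G (comp_of G u))) => [|nuC]; first by move/IH; apply.
  rewrite add_edgeC; apply: IH; last by rewrite eq_sym.
  by move: uv; rewrite eq_part // nuC /= negb_or negbK => /andP[].
rewrite eq_part // uC orbF => uv.
apply: (addC (H := induced G (comp_of G u)) _ _ gG AG _ (giso_refl _)).
- exact: induced_is_graph.
- exact/asboolP.
- by rewrite componentsE imset_f ?inE.
- by rewrite inE connect0.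
- by rewrite inE.
Qed.

Variable n : nat.

Lemma An_is_graph G : G \in An A n -> is_graph G.
Proof. by rewrite inE => /andP[]. Qed.

Lemma An_add_cross G u v : G \in An A n -> part C G u != part C G v ->
  add_edge G u v \in An A n.
Proof.
move=> GA uv; have gG := An_is_graph GA.
have /andP[_ /asboolP AG] : is_graph G && `[< A G >] by move: GA; rewrite inE.
rewrite inE is_graph_add //=; last by apply: contraNneq uv => ->.
exact/asboolP/class_add_cross.
Qed.

(** Parts are unions of components, so there are at most as many parts as components. *)
Lemma card_bridges_kappa_plus (G : graph 'I_n) : is_graph G ->
  #|bridges G| <= 2 * (n - kappa_plus C G).
Proof.
move=> gG; have := card_bridges gG; have := kappa_plus_le_components C G.
rewrite card_ord mulnBr; move: #|bridges G| #|components G| (kappa_plus C G).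
by move=> b c k; lia.
Qed.

Definition level k : {set graph 'I_n} := [set G in An A n | kappa_plus C G == k].

Lemma kappa_plus_le_order (G : graph 'I_n) : kappa_plus C G <= n.
Proof.
apply: leq_trans (kappa_plus_le_components C G) _.
by rewrite componentsE (leq_trans (leq_imset_card _ _)) // cardsT card_ord.
Qed.

Lemma card_level_succ k : 0 < k -> #|level k.+1| * k <= #|level k|.
Proof.
(* An inhabited level [k.+1] forces [k < n], so the factor [2 * (n - k)] common to [lower] and
   [upper] can be cancelled. *)
move=> k0; case: (set_0Vmem (level k.+1)) => [->|[G0]]; first by rewrite cards0.
rewrite inE => /andP[_ /eqP kG0]; have := kappa_plus_le_order G0; rewrite kG0 => kn.
have lev G j : G \in level j -> is_graph G /\ kappa_plus C G = j.
  by rewrite inE => /andP[/An_is_graph gG /eqP].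
have cross_bridges :
    \sum_(G in level k.+1) #|cross C G| <= \sum_(G in level k) #|bridges G|.
  apply: sum_cross_le_bridges => [G /lev[]//|G u v Gk uv].
  have [gG kG] := lev _ _ Gk; have := Gk; rewrite inE => /andP[GA _].
  rewrite inE An_add_cross //= -eqSS -kG.
  by rewrite (kappa_plus_add_edge isoC stableC gG uv).
have lower : #|level k.+1| * (2 * (k * (n - k))) <=
    \sum_(G in level k.+1) #|cross C G|.
  rewrite -sum_nat_const; apply: leq_sum => G /lev[gG kG].
  by rewrite -[n in n - k]card_ord; apply: card_cross_ge; rewrite -kappa_plusE.
have upper : \sum_(G in level k) #|bridges G| <= #|level k| * (2 * (n - k)).
  rewrite -sum_nat_const; apply: leq_sum => G /lev[gG <-].
  exact: card_bridges_kappa_plus.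
have := leq_trans lower (leq_trans cross_bridges upper).
rewrite [X in _ <= X -> _]mulnCA [X in X <= _ -> _]mulnCA leq_pmul2l //.
by rewrite mulnA leq_pmul2r // subn_gt0.
Qed.

(** The index [j] is [kappa_plus C G - 1], the quantity to be compared with [Po(1)]. *)
Lemma sum_card_level m N : m <= N ->
  \sum_(m <= j < N) #|level j.+1| = #|[set G in An A n | m < kappa_plus C G <= N]|.
Proof.
elim: N => [|N IHN] mN.
  by rewrite big_geq // (_ : [set _ in _ | _] = set0) ?cards0 //;
    apply/setP => G; rewrite !inE; lia.
move: mN; rewrite leq_eqVlt => /orP[/eqP->|mN].
  by rewrite big_geq // (_ : [set _ in _ | _] = set0) ?cards0 //;
    apply/setP => G; rewrite !inE; lia.
rewrite big_nat_recr //= IHN // -cardsUI.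
rewrite (_ : _ :&: _ = set0) ?cards0 ?addn0; last first.
  by apply/setP => G; rewrite !inE; lia.
by apply: eq_card => G; rewrite !inE; lia.
Qed.

Lemma sum_frag_lt (L : graph 'I_n -> {set 'I_n}) :
  0 < #|An A n| ->
  (forall G, G \in An A n -> 0 < #|components G| ->
     L G \in components G /\ forall K, K \in components G -> #|K| <= #|L G|) ->
  \sum_(G in An A n) frag C G (L G) < 2 * #|An A n|.
Proof.
(* Without vertices there are no components, hence no largest one, and every [frag] is an empty
   sum. *)
move=> A0 HL; case: (posnP n) => [n0|n_gt0].
  rewrite big1 ?muln_gt0 // => G _; rewrite /frag big1 // => K /andP[].
  rewrite inE componentsE => /andP[/imsetP[x _ _] _].
  by have := leq_ltn_trans (leq0n x) (ltn_ord x); rewrite [X in 0 < X]n0.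
rewrite -(ltn_pmul2l n_gt0) big_distrr /=.
have lower : \sum_(G in An A n) n * frag C G (L G) <= \sum_(G in An A n) #|cross C G|.
  apply: leq_sum => G GA; have gG := An_is_graph GA.
  have [|LG Lmax] := HL G GA.
    by apply: leq_trans (kappa_plus_le_components C G); rewrite kappa_plus_gt0 ?card_ord.
  by rewrite -[n in n * _]card_ord; apply: frag_cross.
have cross_bridges : \sum_(G in An A n) #|cross C G| <= \sum_(G in An A n) #|bridges G|.
  by apply: sum_cross_le_bridges; [exact: An_is_graph | exact: An_add_cross].
(* The strict inequality comes from here: there is at least one part, so [n] improves to [n.-1]. *)
have upper : \sum_(G in An A n) #|bridges G| <= #|An A n| * (2 * n.-1).
  rewrite -sum_nat_const; apply: leq_sum => G /An_is_graph gG.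
  apply: leq_trans (card_bridges_kappa_plus gG) _.
  have := kappa_plus_gt0 C G; rewrite card_ord => /(_ n_gt0); lia.
apply: leq_ltn_trans (leq_trans lower (leq_trans cross_bridges upper)) _.
by rewrite mulnCA [X in _ < X]mulnCA ltn_pmul2l // mulnC ltn_pmul2r // ltn_predL.
Qed.

End Counting.

(** * Comparison with the Poisson law *)

Section Poisson.
Variable R : realType.

Local Notation invfact j := (j`!%:R^-1 : R).

Lemma sum_invfact_le_exp N : \sum_(0 <= j < N) invfact j <= expR 1.
Proof.
have -> : \sum_(0 <= j < N) invfact j = series (exp_coeff (1 : R)) N.
  by apply: eq_bigr => j _; rewrite /exp_coeff /= expr1n mul1r.
apply: nondecreasing_cvgn_le; last exact: is_cvg_series_exp_coeff.
by apply: nondecreasing_series => j _ _; exact: exp_coeff_ge0.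
Qed.

(** The complement of the tail is finite, so its mass is a finite sum. *)
Lemma poisson1_tail m :
  poisson_prob (1 : R) 0%N [set k | (m <= k)%N]%classic =
  (1 - (\sum_(0 <= j < m) invfact j) / expR 1)%:E.
Proof.
have -> : [set k | (m <= k)%N]%classic = (~` `I_m)%classic.
  by apply/seteqP; split => k /=; [rewrite leqNgt => /negP | move/negP; rewrite -leqNgt].
rewrite probability_setC // EFinB; congr (_ - _)%E.
rewrite /= /poisson_prob ltr01 esum_fset //; last first.
  by move=> k _; rewrite lee_fin poisson_pmf_ge0.
rewrite -fsbig_ord sumEFin big_mkord mulr_suml; congr (_%:E).
by apply: eq_bigr => j _; rewrite /poisson_pmf ltr01 expr1n mul1r expRN.
Qed.

(* b j * j! is nonincreasing, so the law proportional to b is below Po(1) in the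
   likelihood ratio order. *)
Lemma likelihood_ratio_tail (b : nat -> nat) (m N : nat) :
  (forall j, b j.+1 * j.+1 <= b j)%N -> (m <= N)%N ->
  (\sum_(m <= j < N) b j)%:R <=
    (\sum_(0 <= j < N) b j)%:R * (1 - (\sum_(0 <= j < m) invfact j) / expR 1) :> R.
Proof.
move=> bS mN; set s := \sum_(0 <= j < m) _; set e := expR 1.
have e0 : 0 < e by exact: expR_gt0.
pose c j := (b j * j`!)%N.
have c_mono i j : (i <= j)%N -> (c j <= c i)%N.
  elim: j => [|j IHj]; first by rewrite leqn0 => /eqP->.
  rewrite leq_eqVlt => /orP[/eqP->//|/IHj]; apply: leq_trans.
  by rewrite /c factS mulnA leq_mul2r bS orbT.
have bE j : (b j)%:R = (c j)%:R * invfact j :> R.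
  by rewrite natrM mulfK // pnatr_eq0 -lt0n fact_gt0.
have inv0 j : 0 <= invfact j by rewrite invr_ge0 ler0n.
rewrite !natr_sum (big_cat_nat (leq0n m) mN) /=.
set D := \sum_(0 <= j < m) _; set U := \sum_(m <= j < N) (b j)%:R.
set s' := \sum_(m <= j < N) invfact j.
have ss' : s + s' <= e by rewrite -big_cat_nat //= sum_invfact_le_exp.
have s0 : 0 <= s by apply: sumr_ge0 => j _.
have s'0 : 0 <= s' by apply: sumr_ge0 => j _.
have D0 : 0 <= D by apply: sumr_ge0 => j _; exact: ler0n.
(* The weights [c] are split at [m]: from [m] on they are at most [c m], and before [m] at least
   [c m]. *)
have Uc : U <= (c m)%:R * s'.
  rewrite mulr_sumr; apply: ler_sum_nat => j /andP[mj _].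
  by rewrite bE ler_wpM2r // ler_nat c_mono.
have Dc : (c m)%:R * s <= D.
  rewrite mulr_sumr; apply: ler_sum_nat => j /andP[_ jm].
  by rewrite bE ler_wpM2r // ler_nat c_mono // ltnW.
(* After multiplication by [e] and cancellation of [U * e], the goal is exactly this inequality; it
   follows from [U * s <= c m * s' * s <= D * s']. *)
have Us : U * s <= D * (e - s).
  apply: (@le_trans _ _ ((c m)%:R * s' * s)); first by rewrite ler_wpM2r.
  apply: (@le_trans _ _ (D * s')); first by rewrite mulrAC ler_wpM2r.
  by rewrite ler_wpM2l //; lra.
rewrite -(ler_pM2r e0) -mulrA mulrBl mul1r divfK ?gt_eqF //.
by rewrite mulrDl; lra.
Qed.

End Poisson.

Theorem theorem4p1 (R : realType) (A C : gclass) :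
  iso_closed A -> iso_closed C ->
  (forall (T : finType) (G : graph T), is_graph G -> C T G -> gconnected G) ->
  bridge_stable C ->
  (forall (T : finType) (H : graph T), is_graph H -> C T H -> bridge_addable A H) ->
  forall n : nat, (0 < #|An A n|)%N ->
    (* kappa^+(R_n, C) is stochastically dominated by 1 + Po(1) *)
    (forall t : R,
       ((#|[set G in An A n | t < (kappa_plus C G)%:R]|%:R / #|An A n|%:R)%:E
        <= poisson_prob (1 : R) 0%N [set k : nat | (t < (1 + k)%:R)%R])%E)
    /\
    (* E[frag(R_n, C)] < 2, for any choice of the deleted largest component *)
    (forall L : graph 'I_n -> {set 'I_n},
       (forall G, G \in An A n -> (0 < #|components G|)%N ->
          L G \in components G /\
          forall K, K \in components G -> #|K| <= #|L G|)%N ->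
       (\sum_(G in An A n) (frag C G (L G))%:R) / #|An A n|%:R < 2 :> R).
Proof.
move=> _ isoC _ stableC addC n A0.
have A0R : 0 < #|An A n|%:R :> R by rewrite ltr0n.
split=> [t|L HL]; last first.
  by rewrite ltr_pdivrMr // -natr_sum -natrM ltr_nat sum_frag_lt.
(* The least [m] with [t < 1 + m] turns the real threshold into an integer one: the Poisson event
   becomes [m <= k]. *)
have exm : exists m : nat, t < (1 + m)%:R.
  exists (Num.bound `|t|); rewrite natrD.
  by have := archi_boundP (normr_ge0 t); have := ler_norm t; lra.
case: (ex_minnP exm) => m tm mmin.
have -> : [set k : nat | (t < (1 + k)%:R)%R]%classic = [set k | (m <= k)%N]%classic.
  apply/seteqP; split => k /= => [/mmin//|mk].
  by apply: lt_le_trans tm _; rewrite ler_nat leq_add2l.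
case: (posnP m) => [m0|m_gt0].
  rewrite (_ : [set k | (m <= k)%N]%classic = setT); last first.
    by apply/seteqP; split => k //= _; rewrite m0.
  rewrite probability_setT lee_fin ler_pdivrMr // mul1r ler_nat.
  by apply/subset_leq_card/fintype.subsetP => G; rewrite inE => /andP[].
(* By minimality of [m > 0], [t] lies between [m] and [m + 1], so exceeding [t] means exceeding [m]
   for an integer. *)
have mt : m%:R <= t.
  by rewrite leNgt; apply/negP => tm'; have := mmin m.-1; rewrite add1n prednK // => /(_ tm'); lia.
rewrite poisson1_tail lee_fin ler_pdivrMr // mulrC.
(* The upper limit [m + n] excludes nothing, since [kappa_plus] is at most [n]; it makes the range
   finite and keeps it above [m]. *)
have -> : [set G in An A n | t < (kappa_plus C G)%:R] =
    [set G in An A n | m < kappa_plus C G <= m + n]%N.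
  apply/setP => G; rewrite !finset.in_set; congr (_ && _).
  rewrite (leq_trans (kappa_plus_le_order C G)) ?leq_addl // andbT.
  apply/idP/idP => [tk|mk]; first by rewrite -(ltr_nat R); apply: le_lt_trans tk.
  by apply: lt_le_trans tm _; rewrite ler_nat add1n.
rewrite -sum_card_level ?leq_addr //.
(* Here [b j] is the size of level [j.+1]; the total of these sizes is then bounded by the size of
   [An]. *)
apply: le_trans (likelihood_ratio_tail R _ (leq_addr n m)) _.
  by move=> j; apply: card_level_succ.
rewrite ler_wpM2r //.
  by rewrite subr_ge0 ler_pdivrMr ?expR_gt0 // mul1r sum_invfact_le_exp.
rewrite ler_nat sum_card_level //.
by apply/subset_leq_card/fintype.subsetP => G; rewrite inE => /andP[].
Qed.
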